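(* (i) Let $s$ be a prime power, and let $\lambda$ and $q\le p$ be positive integers with $\lambda s^p-1\ge 2$. Suppose a generalized Hadamard matrix $\mathrm{GH}(\lambda s^p,s^p)$ exists. Then there exists a $\mathrm{GSOA}(\lambda s^p,\lambda s^p-1,s^q,t)$ that attains the lower bounds $G^{\rm LB}$ and $\Phi_{\rm SD}^{\rm LB}$, where $t=2$ if $s=2$ and $t=1$ if $s>2$. (ii) For any prime power $s$, there exists a balanced $\mathrm{GSOA}(s^2,s+1,s^2,2)$ that attains the lower bounds $G^{\rm LB}$ and $\Phi_{\rm SD}^{\rm LB}$.
   Context: Generalized Hadamard matrices. For a prime power $r$, let $\mathrm{GF}(r)$ be the finite field of order $r$. An $n\times n$ array with entries in $\mathrm{GF}(r)$ is a generalized Hadamard matrix $\mathrm{GH}(n,r)$ if for every pair of distinct columns, each element of $\mathrm{GF}(r)$ appears exactly $n/r$ times in the componentwise difference of those columns. Notation: for a positive integer $r$, $\mathbb{Z}_r=\{0,1,\ldots,r-1\}$. An $(n,m,s^h)$ design is an $n\times m$ matrix $D=(x_{ik})$ with entries in $\mathbb{Z}_{s^h}$ (rows may repeat). Orthogonal arrays. An $\mathrm{OA}(n,g,s_1\times\cdots\times s_g,t)$ is an $n\times g$ matrix whose $j$th column takes values in $\mathbb{Z}_{s_j}$ and such that in any $t$-column subarray all possible level combinations appear equally often. GSOA. A general strong orthogonal array $\mathrm{GSOA}(n,m,s^h,t)$ is an $(n,m,s^h)$ design such that any subarray of $g$ columns ($1\le g\le t$) can be collapsed into an $\mathrm{OA}(n,g,s^{u_1}\times\cdots\times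 s^{u_g},g)$ for any positive integers $u_1,\ldots,u_g$ with $u_1+\cdots+u_g=t$ and $u_i\le h$; here the collapsing map from $s^h$ levels to $s^u$ levels is $x\mapsto\lfloor x/s^{h-u}\rfloor$. A design is balanced, or U-type, if each of its columns contains every level equally often; the bounds below concern U-type designs. Weights and distances for designs with $s^h$ levels. Let $\omega:\{0,\ldots,h\}\to[0,\infty)$ be a (given) weight function with $\omega(i)>0$ for at least one $i$. Put $z_{ik}=(2x_{ik}+1)/(2s^h)\in[0,1)$, $\delta_i(x,y)=1$ if $\lfloor s^ix\rfloor=\lfloor s^iy\rfloor$ and $0$ otherwise, and $$d_{ab}=\sum_{k=1}^m\sum_{i=0}^h\frac{\omega(i)}{s^i}\{1-\delta_i(z_{ak},z_{bk})\},\qquad G_D=\sum_{a=1}^n\sum_{b=1}^n d_{ab}^2 .$$ Criterion. For $u\in\{0,\ldots,h\}$, $x\in[0,1)$ let $R_u(x)=[\lfloor s^ux\rfloor/s^u,\lfloor s^ux\rfloor/s^u+1/s^u)$. For $n$ points $P$ (with multiplicity) in $[0,1)^2$, $$\mathrm{SD}^2(P)=\sum_{u_1,u_2=0}^{h}\omega(u_1)\omega(u_2)\int_{[0,1)^2}\left|s^{-u_1-u_2}-\frac{|P\cap(R_{u_1}(x_1)\times R_{u_2}(x_2))|}{n}\right|^2dx_1dx_2,$$ and for $m\ge2$, $\Phi_{\rm SD}(D)=\frac{2}{m(m-1)}\sum_{1\le k<l\le m}\mathrm{SD}^2(P_{kl})$ with $P_{kl}=\{(z_{ik},z_{il})\}_{i=1}^n$.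 Lower bounds. With $A_0=\sum_{i=0}^h\omega(i)s^{-i}$, $A_1=\sum_{i=0}^h\omega(i)s^{-2i}$, $B=\sum_{i=0}^h\omega(i)^2s^{-3i}$, $C=\sum_{0\le i<j\le h}\omega(i)\omega(j)s^{-i-2j}$, put $$G^{\rm LB}=\frac{n^3m^2}{n-1}(A_0-A_1)^2,$$ $$\Phi_{\rm SD}^{\rm LB}=\frac{m}{(n-1)(m-1)}A_0^2-\frac{2m}{(n-1)(m-1)}A_0A_1+\frac{n+m-1}{(n-1)(m-1)}A_1^2-\frac{1}{m-1}B-\frac{2}{m-1}C .$$ A design $D$ ''attains the lower bounds'' if it is U-type, $G_D=G^{\rm LB}$ and $\Phi_{\rm SD}(D)=\Phi_{\rm SD}^{\rm LB}$. In (i) these are taken with $n=\lambda s^p$, $m=\lambda s^p-1$, $h=q$; in (ii) with $n=s^2$, $m=s+1$, $h=2$. *)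

(* Defs.v *)
From mathcomp Require Export all_boot all_order all_algebra.
From mathcomp Require Export all_classical all_reals all_analysis.

Set Implicit Arguments.
Unset Strict Implicit.
Unset Printing Implicit Defensive.

Import Order.TTheory GRing.Theory Num.Theory.

Local Open Scope ring_scope.

Definition prime_power (s : nat) : Prop :=
  exists p k : nat, [/\ prime p, (0 < k)%N & s = (p ^ k)%N].

(* "Exactly n/r times" is written multiplicatively to avoid truncated
   division. *)
Definition is_GH (F : finFieldType) (n : nat) (H : 'M[F]_n) : Prop :=
  forall j k : 'I_n, j != k ->
  forall c : F, (#|[set i | (H i j - H i k == c)%R]| * #|F|)%N = n.

Definition GH_exists (n r : nat) : Prop :=
  exists (F : finFieldType) (H : 'M[F]_n), #|F| = r /\ is_GH H.

Definition design (n m s h : nat) : Type := 'M['I_(s ^ h)%N]_(n, m).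

(* A mixed-level array has natural number entries, the j-th column being
   bounded by lev j.  A t-column subarray is given by the set J of its columns;
   only the values of v and w on J matter. *)
Definition is_OA (n g : nat) (lev : 'I_g -> nat) (t : nat) (A : 'M[nat]_(n, g))
    : Prop :=
  (forall i j, A i j < lev j)%N /\
  forall J : {set 'I_g}, #|J| = t ->
  forall v w : 'I_g -> nat,
    (forall j, j \in J -> v j < lev j)%N ->
    (forall j, j \in J -> w j < lev j)%N ->
    #|[set i | [forall j in J, A i j == v j]]| =
    #|[set i | [forall j in J, A i j == w j]]|.

(* Column j of the subarray c goes from s^h to s^(u j) levels. *)
Definition collapse (n m s h : nat) (D : design n m s h) (g : nat)
    (c : 'I_g -> 'I_m) (u : 'I_g -> nat) : 'M[nat]_(n, g) :=
  \matrix_(i, j) (D i (c j) %/ s ^ (h - u j))%N.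

Definition is_GSOA (n m s h t : nat) (D : design n m s h) : Prop :=
  forall g : nat, (1 <= g <= t)%N ->
  forall c : 'I_g -> 'I_m, injective c ->
  forall u : 'I_g -> nat,
    (forall j, 0 < u j <= h)%N -> (\sum_j u j)%N = t ->
    is_OA (fun j => s ^ u j)%N g (collapse D c u).

Definition balanced (n m s h : nat) (D : design n m s h) : Prop :=
  forall (k : 'I_m) (x y : 'I_(s ^ h)%N),
    #|[set i | D i k == x]| = #|[set i | D i k == y]|.

Definition weight_function (R : realType) (h : nat) (w : 'I_h.+1 -> R)
    : Prop :=
  (forall i, 0 <= w i) /\ exists i, 0 < w i.

Definition zpoint (R : realType) (n m s h : nat) (D : design n m s h)
    (i : 'I_n) (k : 'I_m) : R :=
  ((2 * D i k + 1)%N)%:R / ((2 * s ^ h)%N)%:R.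

Definition delta (R : realType) (s i : nat) (x y : R) : R :=
  (Num.floor (s%:R ^+ i * x) == Num.floor (s%:R ^+ i * y))%:R.

Definition dist (R : realType) (n m s h : nat) (w : 'I_h.+1 -> R)
    (D : design n m s h) (a b : 'I_n) : R :=
  \sum_(k < m) \sum_(i < h.+1)
    w i / s%:R ^+ i * (1 - delta s i (zpoint R D a k) (zpoint R D b k)).

Definition G_D (R : realType) (n m s h : nat) (w : 'I_h.+1 -> R)
    (D : design n m s h) : R :=
  \sum_(a < n) \sum_(b < n) dist w D a b ^+ 2.

Definition cell (R : realType) (s u : nat) (x : R) : interval R :=
  let l := (Num.floor (s%:R ^+ u * x))%:~R / s%:R ^+ u in
  `[l, l + 1 / s%:R ^+ u[.

(* Indexing the points by 'I_n counts them with multiplicity. *)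
Definition cell_count (R : realType) (n s u1 u2 : nat) (P : 'I_n -> R * R)
    (x : R * R) : nat :=
  #|[set i | ((P i).1 \in cell s u1 x.1) && ((P i).2 \in cell s u2 x.2)]|.

Definition SD2 (R : realType) (n s h : nat) (w : 'I_h.+1 -> R)
    (P : 'I_n -> R * R) : R :=
  \sum_(u1 < h.+1) \sum_(u2 < h.+1) w u1 * w u2 *
    \int[(@lebesgue_measure R \x @lebesgue_measure R)%E]_(x in
        `[0, 1[%classic `*` `[0, 1[%classic)
      `| s%:R ^- (u1 + u2) - (cell_count s u1 u2 P x)%:R / n%:R | ^+ 2.

Definition Phi_SD (R : realType) (n m s h : nat) (w : 'I_h.+1 -> R)
    (D : design n m s h) : R :=
  2 / (m%:R * (m%:R - 1)) *
  \sum_(k < m) \sum_(l < m | (k < l)%N)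
    SD2 s w (fun i => (zpoint R D i k, zpoint R D i l)).

Section LowerBounds.
Variables (R : realType) (n m s h : nat) (w : 'I_h.+1 -> R).

Definition A0 : R := \sum_(i < h.+1) w i * s%:R ^- i.
Definition A1 : R := \sum_(i < h.+1) w i * s%:R ^- (2 * i).
Definition Bw : R := \sum_(i < h.+1) w i ^+ 2 * s%:R ^- (3 * i).
Definition Cw : R :=
  \sum_(i < h.+1) \sum_(j < h.+1 | (i < j)%N) w i * w j * s%:R ^- (i + 2 * j).

Definition G_LB : R :=
  n%:R ^+ 3 * m%:R ^+ 2 / (n%:R - 1) * (A0 - A1) ^+ 2.

Definition Phi_LB : R :=
  m%:R / ((n%:R - 1) * (m%:R - 1)) * A0 ^+ 2
  - 2 * m%:R / ((n%:R - 1) * (m%:R - 1)) * A0 * A1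
  + (n%:R + m%:R - 1) / ((n%:R - 1) * (m%:R - 1)) * A1 ^+ 2
  - 1 / (m%:R - 1) * Bw
  - 2 / (m%:R - 1) * Cw.

End LowerBounds.

Definition attains_bounds (R : realType) (n m s h : nat) (w : 'I_h.+1 -> R)
    (D : design n m s h) : Prop :=
  [/\ balanced D, G_D w D = G_LB n m s w & Phi_SD w D = Phi_LB n m s w].

(* Main.v *)
Require Import Defs.
From mathcomp Require Import all_fingroup all_field.
From mathcomp Require Import measurable_realfun ring lra zify.

(* Both bounds are attained by every balanced design in which any two distinct
   rows are at the same distance.  Writing S_k(a, b) for the weighted number of
   levels at which rows a and b agree in column k, integrating the piecewise
   constant discrepancy gives SD2(P_kl) = n^-2 sum_ab S_k S_l - A1^2, so that
   Phi_SD is determined by the d_ab = sum_k (A0 - S_k(a, b)) and by the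
   sum_ab S_k^2, and balance fixes the latter as n^2 (B + 2 C).

   (i) The transpose of a generalized Hadamard matrix over a field is again one.
   After subtracting the first column and deleting it, the differences of two
   rows are therefore as uniform as possible, and numbering the field by the
   base s digits of its coordinates turns agreement at level i into membership
   of a difference in an additive subgroup of index s^i.

   (ii) The rows are the points of the affine plane of order s and the columns
   its parallel classes; the leading digit of an entry names the line through
   the point and the second digit the position on that line.  Two points lie
   on exactly one common line. *)

Set Implicit Arguments.
Unset Strict Implicit.
Unset Printing Implicit Defensive.

Import Order.TTheory GRing.Theory Num.Theory.

Local Open Scope ring_scope.

(** * Finite sums and one-sided inverses *)

Lemma sum_mul_inverse_comm (K : comPzRingType) (T : finType) (f g : T -> T -> K) :
  (forall x y, \sum_z f x z * g z y = (x == y)%:R) ->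
  forall x y, \sum_z g x z * f z y = (x == y)%:R.
Proof.
move=> fg x y.
pose M (h : T -> T -> K) : 'M[K]_#|T| := \matrix_(i, j) h (enum_val i) (enum_val j).
have MM h k a b : (M h *m M k) (enum_rank a) (enum_rank b) = \sum_z h a z * k z b.
  rewrite mxE [RHS](reindex _ (onW_bij _ (enum_val_bij _))) /=.
  by apply: eq_bigr => i _; rewrite !mxE !enum_rankK.
(* Over a commutative ring a one-sided inverse of a square matrix is two-sided. *)
have /mulmx1C MG : M f *m M g = 1%:M.
  apply/matrixP => i j; rewrite -[i]enum_valK -[j]enum_valK MM fg mxE.
  by rewrite (inj_eq enum_rank_inj).
by rewrite -MM MG mxE (inj_eq enum_rank_inj).
Qed.

Lemma sum_nat_indic (K : pzSemiRingType) (T : finType) (P : pred T) :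
  \sum_(x : T) (P x)%:R = #|[set x | P x]|%:R :> K.
Proof.
rewrite cardsE -sum1_card natr_sum [RHS]big_mkcond /=.
by apply: eq_bigr => x _; rewrite unfold_in; case: (P x).
Qed.

Lemma big_eq_indicl (K : pzSemiRingType) (T : finType) (a : T) (f : T -> K) :
  \sum_x (x == a)%:R * f x = f a.
Proof.
rewrite (bigD1 a) //= eqxx mul1r big1 ?addr0 // => x /negbTE ->.
by rewrite mul0r.
Qed.

(** * Transposing a generalized Hadamard matrix *)

Section Transpose.
Variables (F : finFieldType) (n : nat) (H : 'M[F]_n).
Hypothesis GH : is_GH H.

Let g : rat := #|F|%:R.
(** The indicator of [0] minus its mean: an even function of sum zero, idempotent under convolution
    ([conv_c]). *)
Let c (x : F) : rat := (x == 0)%:R - g^-1.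

Let g_neq0 : g != 0.
Proof. by rewrite pnatr_eq0 -lt0n; apply/card_gt0P; exists 0. Qed.

Let sum_c : \sum_x c x = 0.
Proof.
rewrite sumrB (sum_nat_indic _ (pred1 0)) cardsE card1.
by rewrite sumr_const -[g^-1 *+ _]mulr_natr mulVf ?subrr // g_neq0.
Qed.

Let sum_cB y : \sum_x c (x - y) = 0.
Proof.
rewrite -[RHS]sum_c [RHS](reindex_inj (addIr (- y))) /=.
by apply: eq_bigr.
Qed.

Let conv_c y z : \sum_x c (x - y) * c (x - z) = c (y - z).
Proof.
transitivity (\sum_x (x == y)%:R * c (x - z) - g^-1 * \sum_x c (x - z)).
  rewrite big_distrr -sumrB; apply: eq_bigr => x _ /=.
  by rewrite {1}/c subr_eq0 mulrBl.
by rewrite sum_cB mulr0 subr0 big_eq_indicl.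
Qed.

(** The column condition on [H] enters here: a difference takes the value [y] in n/|F| rows, which
    cancels the mean. *)
Let sum_c_cols k l y : k != l -> \sum_a c (H a k - H a l - y) = 0.
Proof.
move=> kl; apply: (mulIf g_neq0); rewrite mul0r sumrB.
rewrite (eq_bigr (fun a => (H a k - H a l == y)%:R)); last first.
  by move=> a _; rewrite subr_eq0.
rewrite (sum_nat_indic _ (fun a => H a k - H a l == y)) mulrBl -natrM.
by rewrite (GH kl) sumr_const card_ord mulrnAl mulVf ?subrr // g_neq0.
Qed.

(* With M the 0-1 block matrix that has the permutation matrix of the translation
   by [H a k] in block (a, k), W is M minus its mean in each block, plus the
   projection onto the block constant vectors.  The column condition on H says
   that W' is a left inverse of W; being a right inverse is the row condition. *)
Let W (x y : 'I_n * F) : rat :=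
  c (x.2 - (H x.1 y.1 + y.2)) + (x.1 == y.1)%:R / g.
Let W' (y x : 'I_n * F) : rat :=
  c (x.2 - (H x.1 y.1 + y.2)) / n%:R + (x.1 == y.1)%:R / g.

Let n_neq0 (a : 'I_n) : n%:R != 0 :> rat.
Proof. by rewrite pnatr_eq0 -lt0n (leq_trans _ (ltn_ord a)). Qed.

(** In each block row [a] the mixed terms vanish because [c] sums to zero, and the two factors [c]
    convolve into one. Summed over [a], distinct columns give zero by [sum_c_cols], and equal
    columns give [c (v - w) + g^-1], the indicator of [v = w]. *)
Let W'W x y : \sum_z W' x z * W z y = (x == y)%:R.
Proof.
case: x y => [k v] [l w]; rewrite -(pair_bigA _ (fun a u => W' (k, v) (a, u) * W (a, u) (l, w))) /=.
transitivity (\sum_a (c (H a k - H a l - (w - v)) / n%:R + (a == k)%:R * (a == l)%:R / g)).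
  apply: eq_bigr => a _; rewrite /W /W' /=.
  set p := (a == k)%:R; set q := (a == l)%:R.
  transitivity ((\sum_u c (u - (H a k + v)) * c (u - (H a l + w))) / n%:R +
    (p / g) * (\sum_u c (u - (H a l + w))) + (\sum_u c (u - (H a k + v))) * (q / g / n%:R)
     + \sum_(u : F) (p / g) * (q / g)).
    rewrite !big_distrl !big_distrr -!big_split /=.
    by apply: eq_bigr => u _; ring.
  rewrite conv_c !sum_cB sumr_const -[_ *+ #|_|]mulr_natr -/g.
  rewrite (_ : H a k + v - _ = H a k - H a l - (w - v)); last by ring.
  by field; rewrite g_neq0 n_neq0.
rewrite big_split /= -!big_distrl /= big_eq_indicl xpair_eqE.
have [<-|kl] := eqVneq k l; last by rewrite sum_c_cols // !mul0r addr0.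
rewrite (eq_bigr (fun=> c (v - w))); last first.
  by move=> a _; congr c; ring.
rewrite sumr_const card_ord -[_ *+ n]mulr_natr mulfK ?n_neq0 // /c subr_eq0.
by rewrite mul1r subrK.
Qed.

(** The entry at [(a, x)] and [(b, 0)] of the product in the other order vanishes for [a != b]. It
    reduces to a sum of [c] over the row differences, and undoing the centring gives the count. *)
Lemma is_GH_tr : is_GH H^T.
Proof.
move=> a b ab x.
have := sum_mul_inverse_comm W'W (a, x) (b, 0).
rewrite -(pair_bigA _ (fun k v => W (a, x) (k, v) * W' (k, v) (b, 0))) /=.
rewrite xpair_eqE (negbTE ab) /= => E.
have {E} : \sum_k c (H a k - H b k - x) = 0.
  apply: (mulIf (invr_neq0 (n_neq0 a))); rewrite mul0r -[RHS]E big_distrl.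
  apply: eq_bigr => k _ /=.
  rewrite /W /W' /=.
  set p := (a == k)%:R; set q := (b == k)%:R.
  have cC y z : c (y - z) = c (z - y) by rewrite /c -[z - y]opprB oppr_eq0.
  transitivity ((\sum_u c (u - (x - H a k)) * c (u - (- H b k))) / n%:R +
    (p / g) * (\sum_u c (u - (- H b k))) / n%:R + (\sum_u c (u - (x - H a k))) * (q / g)
     + \sum_(u : F) (p / g) * (q / g)).
    rewrite conv_c !sum_cB mulr0 !mul0r !addr0.
    (* No [k] equals both [a] and [b]. *)
    rewrite (_ : p / g * (q / g) = 0) ?big1 ?addr0 //; last first.
      rewrite /p /q; case: eqP => [<-|]; rewrite ?mul0r //.
      by rewrite eq_sym (negbTE ab) mul0r mulr0.
    rewrite cC opprK addrC; congr (c _ / _); ring.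
  rewrite !big_distrl !big_distrr !big_distrl -!big_split /=.
  apply: eq_bigr => v _; rewrite ![c (v - _)]cC opprD addrA sub0r opprD.
  by ring.
move/(congr1 (fun y => y * g)); rewrite mul0r sumrB.
rewrite (eq_bigr (fun k => (H a k - H b k == x)%:R)); last first.
  by move=> k _; rewrite subr_eq0.
rewrite (sum_nat_indic _ (fun k => H a k - H b k == x)) mulrBl -natrM.
rewrite sumr_const card_ord mulrnAl mulVf ?g_neq0 //.
move/eqP; rewrite subr_eq0 eqr_nat => /eqP E; rewrite -[RHS]E.
by congr (_ * _)%N; apply: eq_card => k; rewrite !inE !mxE.
Qed.

End Transpose.

(** * Numbering a finite field *)

(** The digit [d 0] is the most significant one, so that division by [p ^ j] truncates the
    sequence. *)
Fixpoint horner_digits (p : nat) (d : nat -> nat) (M : nat) : nat :=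
  if M is M'.+1 then (horner_digits p d M' * p + d M')%N else 0%N.

Lemma horner_digits_divn p d M j : (forall i, d i < p)%N ->
  (horner_digits p d (M + j) %/ p ^ j)%N = horner_digits p d M.
Proof.
move=> dp; have p0 : (0 < p)%N by apply: leq_ltn_trans (dp 0%N).
elim: j => [|j IH]; first by rewrite addn0 divn1.
by rewrite addnS expnS divnMA /= divnMDl // [(d _ %/ _)%N]divn_small // addn0 IH.
Qed.

Lemma horner_digits_lt p d M : (forall i, d i < p)%N ->
  (horner_digits p d M < p ^ M)%N.
Proof.
move=> dp; have p0 : (0 < p)%N by apply: leq_ltn_trans (dp 0%N).
elim: M => //= M IH; rewrite expnSr (leq_trans (n := horner_digits p d M * p + p)%N) //.
  by rewrite ltn_add2l.
by rewrite addnC -mulSn leq_mul2r IH orbT.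
Qed.

Lemma horner_digits_eq p d e M : (forall i, d i < p)%N -> (forall i, e i < p)%N ->
  (horner_digits p d M == horner_digits p e M) = [forall i : 'I_M, d i == e i].
Proof.
move=> dp ep; have p0 : (0 < p)%N by apply: leq_ltn_trans (dp 0%N).
elim: M => [|M IH]; first by apply/esym/forallP => -[].
apply/eqP/forallP => [/= E i | E].
  have := congr1 (divn^~ p) E; have := congr1 (modn^~ p) E.
  rewrite /= !modnMDl !divnMDl // !modn_small // !divn_small // !addn0.
  move=> EM /eqP; rewrite IH => /forallP Elt.
  have [iM|] := ltnP i M; first exact: (Elt (Ordinal iM)).
  move=> Mi; suff -> : (i : nat) = M by rewrite EM.
  by apply/eqP; rewrite eqn_leq Mi -ltnS ltn_ord.
rewrite /= (eqP (E ord_max)); congr (_ * _ + _)%N; apply/eqP; rewrite IH.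
by apply/forallP => i; have := E (widen_ord (leqnSn M) i).
Qed.

(** The digits are the coordinates over the prime field. Subtraction acts coordinatewise, so the
    leading digits of [x] and [y] agree exactly when those of [x - y] vanish. *)
Lemma digit_numbering (F : finFieldType) (p N : nat) :
  prime p -> #|F| = (p ^ N)%N ->
  exists phi : F -> nat,
    [/\ injective phi, forall x, (phi x < p ^ N)%N &
     forall j x y, (j <= N)%N ->
       (phi x %/ p ^ j == phi y %/ p ^ j)%N = (phi (x - y)%R < p ^ j)%N].
Proof.
move=> pr_p cardF.
have charF := card_finPcharP cardF pr_p.
have EN : logn p #|F| = N by rewrite cardF pfactorK.
have [f f_lin [g fK gK]] := pprimeChar_vectAxiom charF.
move: f f_lin g fK gK; rewrite EN => f f_lin g fK gK.
have fB (x y : pPrimeCharType charF) : f (x - y) = f x - f y.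
  by rewrite addrC -scaleN1r f_lin scaleN1r addrC.
(* Digits past the last coordinate default to 0, to give a total sequence. *)
pose d (x : F) (i : nat) : nat := if insub i is Some k then f x 0 k : nat else 0%N.
have p_gt0 := prime_gt0 pr_p.
have d_lt x i : (d x i < p)%N.
  rewrite /d; case: insubP => // k _ _.
  by rewrite -[ltnRHS](Fp_cast pr_p) ltn_ord.
have dB x y i : (d x i == d y i) = (d (x - y)%R i == 0%N).
  rewrite /d; case: insubP => [k _ _|_]; last by rewrite eqxx.
  by rewrite fB !mxE -[RHS]/(f x 0 k - f y 0 k == 0) subr_eq0.
exists (fun x => horner_digits p (d x) N); split => [x y /eqP||].
- rewrite horner_digits_eq // => /forallP E; apply: (can_inj fK).
  apply/rowP => k; have := E k; rewrite /d insubT // => lt_k /eqP.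
  rewrite (_ : Sub _ _ = k); first exact: val_inj.
  exact: val_inj.
- by move=> x; apply: horner_digits_lt.
move=> j x y jN; rewrite -(subnK jN) !horner_digits_divn // horner_digits_eq //.
rewrite [RHS](_ : _ = (horner_digits p (d (x - y)%R) (N - j) == 0)%N).
  rewrite (_ : 0%N = horner_digits p (fun=> 0%N) (N - j)); last first.
    by elim: (N - j)%N => //= M <-; rewrite mul0n.
  by rewrite horner_digits_eq //; apply: eq_forallb => i; rewrite dB.
rewrite -(horner_digits_divn (N - j) j (d_lt (x - y))).
by rewrite -[in RHS]leqn0 -[(_ <= 0)%N]ltnS ltn_divLR ?expn_gt0 ?p_gt0 // mul1n.
Qed.

(** * The discrepancy of a point set *)

(** Nonnegative coefficients let the sum leave the integral without integrability conditions. *)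
Lemma Rintegral_step (d : measure_display) (T : measurableType d) (R : realType)
    (mu : measure T R) (D : set T) (I : finType) (A : I -> set T) (v a : I -> R)
    (f : T -> R) :
  measurable D -> (forall i, measurable (A i)) -> (forall i, (A i `<=` D)%classic) ->
  (forall i, 0 <= v i) -> (forall i, mu (A i) = (a i)%:E) ->
  (forall x, D x -> f x = \sum_i v i * \1_(A i) x) ->
  \int[mu]_(x in D) f x = \sum_i v i * a i.
Proof.
move=> mD mA AD v0 muA fE; rewrite /Rintegral.
under eq_integral => x /set_mem /fE -> do rewrite -sumEFin.
rewrite ge0_integral_sum //; first last.
- by move=> i x _; rewrite lee_fin mulr_ge0.
- move=> i; apply/measurable_EFinP; apply: measurable_funM => //.
under eq_bigr => i _.
  rewrite (@integralZl_indic _ _ _ mu D mD (fun _ : R => A i) (v i)) //; last by rewrite ltNge v0.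
  rewrite integral_indic // (setIidl (AD i)) muA -EFinM.
  over.
by rewrite sumEFin.
Qed.

Section Cells.
Variables (R : realType) (s : nat).
Hypothesis s_gt0 : (0 < s)%N.

Let su_gt0 u : 0 < s%:R ^+ u :> R.
Proof. by rewrite exprn_gt0 // ltr0n. Qed.

Lemma mem_cell (u : nat) (x y : R) :
  (y \in cell s u x) = (Num.floor (s%:R ^+ u * y) == Num.floor (s%:R ^+ u * x)).
Proof.
rewrite /cell in_itv /= -mulrDl ler_pdivrMr // ltr_pdivlMr // ![y * _]mulrC.
rewrite -[1]/(1%:~R) -intrD.
apply/idP/eqP => [/andP[h1 h2]|<-]; first by apply: floor_def; rewrite h1 h2.
exact: floor_itv.
Qed.

(** A cell named by its index rather than by a point in it, so that the cells of a level form a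
    finite family. *)
Definition level_set (u c : nat) : set R :=
  [set` `[c%:R / s%:R ^+ u, (c%:R + 1) / s%:R ^+ u[].

Lemma level_setE (u c : nat) (x : R) :
  level_set u c x <-> Num.floor (s%:R ^+ u * x) = c.
Proof.
rewrite /level_set /= in_itv /= ler_pdivrMr // ltr_pdivlMr // ![x * _]mulrC.
rewrite -[1]/(1%:~R) -[c%:R]/(c%:~R) -intrD.
split=> [h|<-]; first exact: floor_def.
exact: floor_itv.
Qed.

Lemma measurable_level_set u c : measurable (level_set u c).
Proof. exact: measurable_itv. Qed.

Lemma lebesgue_level_set u c :
  lebesgue_measure (level_set u c) = (s%:R ^- u)%:E.
Proof.
rewrite /level_set lebesgue_measure_itv /= lte_fin ltr_pM2r ?invr_gt0 //.
rewrite ltrDl ltr01 -EFinB -mulrBl addrAC subrr add0r mul1r //.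
Qed.

Lemma level_set_sub u c : (c < s ^ u)%N -> (level_set u c `<=` `[0, 1[)%classic.
Proof.
move=> cs x; rewrite /level_set /= !in_itv /= => /andP[h1 h2]; apply/andP; split.
  by rewrite (le_trans _ h1) // divr_ge0 // ltW.
rewrite (lt_le_trans h2) // ler_pdivrMr // mul1r -natrX natr1 ler_nat //.
Qed.

Lemma floor_level (u : nat) (x : R) : 0 <= x < 1 ->
  exists c : 'I_(s ^ u), Num.floor (s%:R ^+ u * x) = c.
Proof.
move=> /andP[x0 x1].
have f0 : 0 <= Num.floor (s%:R ^+ u * x) by rewrite floor_ge0 mulr_ge0 // ltW.
have f1 : Num.floor (s%:R ^+ u * x) < (s ^ u)%N.
  by rewrite -(ltr_int R) (le_lt_trans (floor_le _)) // -pmulrn natrX gtr_pMr.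
case: (Num.floor _) f0 f1 => // c _; rewrite ltz_nat => lt_c.
by exists (Ordinal lt_c).
Qed.

(** The integrand is constant on each of the s^(u1+u2) rectangles of area [k]. After expanding the
    square, the counts [N c] sum to [n], and their squares count the ordered pairs of points sharing
    a rectangle. *)
Lemma SD2_cell_integral (n u1 u2 : nat) (P : 'I_n -> R * R)
    (c1 : 'I_n -> 'I_(s ^ u1)) (c2 : 'I_n -> 'I_(s ^ u2)) :
  (0 < n)%N ->
  (forall i, Num.floor (s%:R ^+ u1 * (P i).1) = c1 i) ->
  (forall i, Num.floor (s%:R ^+ u2 * (P i).2) = c2 i) ->
  \int[(@lebesgue_measure R \x @lebesgue_measure R)%E]_(x in
        `[0, 1[%classic `*` `[0, 1[%classic)
      `| s%:R ^- (u1 + u2) - (cell_count s u1 u2 P x)%:R / n%:R | ^+ 2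
  = s%:R ^- (u1 + u2) *
    (n%:R ^- 2 * (\sum_a \sum_b (c1 a == c1 b)%:R * (c2 a == c2 b)%:R)
     - s%:R ^- (u1 + u2)).
Proof.
move=> n_gt0 h1 h2.
set k := s%:R ^- (u1 + u2).
pose T := ('I_(s ^ u1) * 'I_(s ^ u2))%type.
pose q i : T := (c1 i, c2 i).
pose N (c : T) : R := \sum_i (q i == c)%:R.
have sumN : \sum_c N c = n%:R.
  rewrite exchange_big /= (eq_bigr (fun=> 1)) ?sumr_const ?card_ord // => i _.
  by under eq_bigr do rewrite eq_sym -[(_ == _)%:R]mulr1; rewrite big_eq_indicl.
have sumN2 : \sum_c N c ^+ 2 = \sum_a \sum_b (c1 a == c1 b)%:R * (c2 a == c2 b)%:R.
  transitivity (\sum_a \sum_b \sum_c (c == q a)%:R * (q b == c)%:R :> R).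
    under [RHS]eq_bigr do rewrite exchange_big /=.
    rewrite [RHS]exchange_big; apply: eq_bigr => c _ /=.
    rewrite expr2 big_distrl; apply: eq_bigr => a _ /=.
    by rewrite big_distrr /= eq_sym.
  apply: eq_bigr => a _; apply: eq_bigr => b _.
  by rewrite big_eq_indicl /q xpair_eqE -mulnb natrM [c1 b == _]eq_sym [c2 b == _]eq_sym.
have sumk : \sum_(c : T) k = 1.
  rewrite sumr_const card_prod !card_ord -expnD -[k *+ _]mulr_natr natrX mulVf //.
  by rewrite gt_eqF.
have n_neq0 : n%:R != 0 :> R by rewrite pnatr_eq0 -lt0n.
have St := @Rintegral_step _ _ R (@lebesgue_measure R \x @lebesgue_measure R)%E
  (`[0, 1[%classic `*` `[0, 1[%classic) T
  (fun c => level_set u1 c.1 `*` level_set u2 c.2)%classic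
  (fun c => (k - N c / n%:R) ^+ 2) (fun=> k).
etransitivity; first apply: St.
- by apply: measurableX; apply: measurable_itv.
- by move=> c; apply: measurableX; apply: measurable_level_set.
- move=> [a b] [x y] /= [xa yb]; split => /=.
    by apply: (level_set_sub (ltn_ord a)).
  by apply: (level_set_sub (ltn_ord b)).
- by move=> c; apply: sqr_ge0.
- move=> c; etransitivity.
    by apply: product_measure1E; apply: measurable_level_set.
  rewrite /k exprD invfM EFinM.
  by congr (_ * _)%E; apply: lebesgue_level_set.
- move=> [x y] [/= hx hy].
  rewrite !in_itv /= in hx hy.
  have [a Ea] := floor_level u1 hx; have [b Eb] := floor_level u2 hy.
  (* The point lies in the rectangle [(a, b)] and in no other. *)
  rewrite real_normK ?num_real // (bigD1 (a, b)) //= big1 ?addr0.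
    rewrite indicE mem_set ?mulr1; last by split; apply/level_setE.
    congr ((_ - _ / _) ^+ 2).
    rewrite /cell_count -sum_nat_indic; apply: eq_bigr => i _.
    by rewrite !mem_cell Ea Eb h1 h2 !eqz_nat xpair_eqE.
  move=> [a' b'] neq; rewrite indicE memNset ?mulr0 //= => -[/= /level_setE ha /level_setE hb].
  move: neq; rewrite xpair_eqE -!val_eqE /= -!eqz_nat -Ea -Eb ha hb.
  by rewrite !eqxx.
rewrite -big_distrl /= mulrC; congr (_ * _).
transitivity (k * \sum_(c : T) k - 2 * k / n%:R * (\sum_c N c) + n%:R ^- 2 * \sum_c N c ^+ 2).
  rewrite !big_distrr /= -sumrB -big_split /=; apply: eq_bigr => c _.
  by field.
by rewrite sumN sumN2 sumk; field.
Qed.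

End Cells.

(** * Balanced equidistant designs *)

Lemma card_divn_fiber (N e M c : nat) : N = (M * e)%N -> (c < M)%N ->
  #|[set x : 'I_N | (x %/ e)%N == c]| = e.
Proof.
move=> -> cM; have lt_f (i : 'I_e) : (c * e + i < M * e)%N.
  rewrite (leq_trans (n := c * e + e)%N) ?ltn_add2l //.
  by rewrite addnC -mulSn leq_mul2r cM orbT.
pose f i := Ordinal (lt_f i).
have f_inj : injective f by move=> i j [] /addnI /val_inj.
rewrite -[RHS](card_ord e) -(card_imset _ f_inj).
apply: eq_card => x; rewrite inE; apply/eqP/imsetP => [xc|[i _ ->]].
  have e0 : (0 < e)%N by case: e x {lt_f f f_inj} xc => // -[x]; rewrite muln0.
  exists (Ordinal (ltn_pmod x e0)) => //; apply: val_inj.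
  by rewrite /= -xc -divn_eq.
by rewrite /= divnMDl ?divn_small ?addn0 //; apply: leq_ltn_trans (ltn_ord i).
Qed.

Lemma sum_symmetric (R : comPzRingType) (N : nat) (f : 'I_N -> 'I_N -> R) :
  (forall i j, f i j = f j i) ->
  \sum_i \sum_j f i j = \sum_i f i i + 2 * \sum_(i < N) \sum_(j < N | (i < j)%N) f i j.
Proof.
move=> fC.
have E (i : 'I_N) : \sum_j f i j =
    f i i + \sum_(j < N | (i < j)%N) f i j + \sum_(j < N | (j < i)%N) f i j.
  rewrite (bigID (fun j : 'I_N => (j <= i)%N)) /=.
  rewrite (bigD1 i) //= addrAC; congr (_ + _ + _).
    by apply: eq_bigl => j; rewrite -ltnNge.
  by apply: eq_bigl => j; rewrite ltn_neqAle andbC.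
rewrite (eq_bigr _ (fun i _ => E i)) !big_split /= -addrA; congr (_ + _).
rewrite mulr_natl mulr2n; congr (_ + _).
under eq_bigr do rewrite big_mkcond.
rewrite exchange_big; apply: eq_bigr => i _ /=.
by rewrite -big_mkcond; apply: eq_bigr => j _; rewrite fC.
Qed.

Section Bounds.
Variables (R : realType) (n m s h : nat) (w : 'I_h.+1 -> R) (D : design n m s h).
Hypothesis s_gt0 : (0 < s)%N.

Let s_neq0 u : s%:R ^+ u != 0 :> R.
Proof. by rewrite expf_neq0 // pnatr_eq0 -lt0n. Qed.

(** The leading [u] base [s] digits of an entry, as produced by [collapse]. *)
Definition level_value (u : nat) (k : 'I_m) (a : 'I_n) : nat :=
  (D a k %/ s ^ (h - u))%N.

Lemma level_value_lt u k a : (u <= h)%N -> (level_value u k a < s ^ u)%N.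
Proof.
by move=> uh; rewrite /level_value ltn_divLR ?expn_gt0 ?s_gt0 // -expnD subnKC.
Qed.

(** The points are centres of the finest cells, so the floor truncates the digits of the entry. *)
Lemma floor_zpoint u k a : (u <= h)%N ->
  Num.floor (s%:R ^+ u * zpoint R D a k) = level_value u k a.
Proof.
move=> uh; rewrite /zpoint /level_value.
set e := (s ^ (h - u))%N; set x := nat_of_ord _.
have e_gt0 : (0 < e)%N by rewrite expn_gt0 s_gt0.
have -> : s%:R ^+ u * ((2 * x + 1)%:R / (2 * s ^ h)%:R) = (2 * x + 1)%:R / (2 * e)%:R :> R.
  rewrite -{1}(subnKC uh) expnD -/e !natrM natrX; field.
  by rewrite s_neq0 pnatr_eq0 -lt0n e_gt0.
apply: floor_def.
rewrite ler_pdivlMr ?ltr_pdivrMr ?ltr0n ?muln_gt0 //.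
rewrite -PoszD -!pmulrn -!natrM ler_nat ltr_nat.
have := leq_trunc_div x e; have := ltn_ceil x e_gt0; lia.
Qed.

Definition agree (u : nat) (k : 'I_m) (a b : 'I_n) : R :=
  (level_value u k a == level_value u k b)%:R.

Lemma delta_zpoint u k a b : (u <= h)%N ->
  delta s u (zpoint R D a k) (zpoint R D b k) = agree u k a b.
Proof. by move=> uh; rewrite /delta !floor_zpoint // eqz_nat. Qed.

Definition similarity (k : 'I_m) (a b : 'I_n) : R :=
  \sum_(i < h.+1) w i * s%:R ^- i * agree i k a b.

Lemma dist_similarity a b : dist w D a b = \sum_k (A0 s w - similarity k a b).
Proof.
apply: eq_bigr => k _; rewrite /A0 -sumrB; apply: eq_bigr => i _.
by rewrite delta_zpoint ?mulrBr ?mulr1 // -ltnS.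
Qed.

(** Agreement at a finer level forces agreement at every coarser one. *)
Lemma agree_mul i j k a b : (i <= j <= h)%N ->
  agree i k a b * agree j k a b = agree j k a b.
Proof.
move=> /andP[ij jh]; rewrite -natrM mulnb /agree; congr (_ %:R); congr nat_of_bool.
apply: andb_idl => /eqP E; rewrite /level_value.
have -> : (h - i = (h - j) + (j - i))%N by lia.
by rewrite expnD !divnMA -!/(level_value j _ _) E.
Qed.

Lemma sum_similarity_mul k l :
  \sum_a \sum_b similarity k a b * similarity l a b =
  \sum_(i < h.+1) \sum_(j < h.+1) w i * w j * (s%:R ^- (i + j) *
    (\sum_a \sum_b agree i k a b * agree j l a b)).
Proof.
transitivity (\sum_a \sum_b \sum_(i < h.+1) \sum_(j < h.+1)
   w i * w j * (s%:R ^- (i + j) * (agree i k a b * agree j l a b))).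
  apply: eq_bigr => a _; apply: eq_bigr => b _.
  rewrite big_distrl; apply: eq_bigr => i _ /=.
  rewrite big_distrr; apply: eq_bigr => j _ /=.
  by rewrite exprD invfM; ring.
under eq_bigr do rewrite exchange_big /=.
rewrite exchange_big; apply: eq_bigr => i _ /=.
under eq_bigr do rewrite exchange_big /=.
rewrite exchange_big; apply: eq_bigr => j _ /=.
rewrite !big_distrr; apply: eq_bigr => a _ /=.
by rewrite !big_distrr.
Qed.

(** For each pair of levels the cell integral is a scaled count of coinciding pairs minus a
    constant. The weighted counts collect into products of similarities, and the constants factor as
    the square of [A1]. *)
Lemma SD2_similarity k l : (0 < n)%N ->
  SD2 s w (fun i => (zpoint R D i k, zpoint R D i l)) =
  n%:R ^- 2 * (\sum_a \sum_b similarity k a b * similarity l a b) - A1 s w ^+ 2.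
Proof.
move=> n_gt0.
pose lv k u (uh : (u < h.+1)%N) a := Ordinal (level_value_lt k a uh).
transitivity (\sum_(i < h.+1) \sum_(j < h.+1) w i * w j * (s%:R ^- (i + j) *
    (n%:R ^- 2 * (\sum_a \sum_b agree i k a b * agree j l a b) - s%:R ^- (i + j)))).
  apply: eq_bigr => i _; apply: eq_bigr => j _; congr (_ * _).
  by apply: (SD2_cell_integral s_gt0 (c1 := lv k i (ltn_ord i)) (c2 := lv l j (ltn_ord j)));
    rewrite // => a /=; rewrite floor_zpoint // -ltnS.
rewrite sum_similarity_mul.
rewrite [A1 s w ^+ 2]expr2 /A1 big_distrl big_distrr -sumrB; apply: eq_bigr => i _ /=.
rewrite !big_distrr -sumrB; apply: eq_bigr => j _ /=.
by rewrite !mul2n -!addnn !exprD !invfM; ring.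
Qed.

Hypothesis D_bal : balanced D.

Lemma balanced_level_count u k c : (u <= h)%N -> (c < s ^ u)%N ->
  (#|[set b | level_value u k b == c]| * s ^ u)%N = n.
Proof.
move=> uh cu.
have h_gt0 : (0 < s ^ h)%N by rewrite expn_gt0 s_gt0.
(* By balance, the multiplicity of the entry 0 is that of every entry. *)
pose N := #|[set i | D i k == Ordinal h_gt0]|.
have fib (P : pred 'I_(s ^ h)) : #|[set b | P (D b k)]| = (#|[set x | P x]| * N)%N.
  rewrite -sum1_card (partition_big (fun b => D b k) P) /=; last first.
    by move=> b; rewrite inE.
  rewrite (eq_bigr (fun=> N)) ?sum_nat_const ?cardsE // => x Px.
  rewrite sum1dep_card /N (D_bal k _ x); apply: eq_card => b.
  by rewrite !inE; case: eqP => [->|]; rewrite ?Px ?andbF.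
rewrite (fib (fun x => (x %/ s ^ (h - u) == c)%N)) (@card_divn_fiber _ _ (s ^ u)) //; last first.
  by rewrite -expnD subnKC.
have := fib predT; rewrite !cardsT !card_ord => {1}->.
by rewrite -[in RHS](subnKC uh) expnD; ring.
Qed.

Lemma sum_agree u k a : (u <= h)%N -> \sum_b agree u k a b = n%:R * s%:R ^- u.
Proof.
move=> uh; rewrite (sum_nat_indic _ (fun b => level_value u k a == level_value u k b)).
rewrite -[in RHS](balanced_level_count k uh (level_value_lt k a uh)) natrM natrX mulfK //.
by congr _%:R; apply: eq_card => b; rewrite !inE eq_sym.
Qed.

Lemma sum_similarity k a : \sum_b similarity k a b = n%:R * A1 s w.
Proof.
rewrite exchange_big /A1 big_distrr; apply: eq_bigr => i _ /=.
by rewrite -big_distrr /= sum_agree -1?ltnS // mul2n -addnn exprD invfM; ring.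
Qed.

(** Within one column the product of two agreements is the agreement at the finer level [j], which
    holds for n^2 s^-j pairs of rows. Equal levels give [Bw], distinct ones twice [Cw]. *)
Lemma sum_similarity_sqr k :
  \sum_a \sum_b similarity k a b * similarity k a b =
  n%:R ^+ 2 * (Bw s w + 2 * Cw s w).
Proof.
rewrite sum_similarity_mul sum_symmetric; last first.
  move=> i j; rewrite addnC [w i * _]mulrC; congr (_ * (_ * _)).
  by apply: eq_bigr => a _; apply: eq_bigr => b _; rewrite mulrC.
have E (i j : 'I_h.+1) : (i <= j)%N ->
    \sum_a \sum_b agree i k a b * agree j k a b = n%:R ^+ 2 * s%:R ^- j.
  move=> ij; have jh : (j <= h)%N by rewrite -ltnS.
  have ijh : (i <= j <= h)%N by rewrite ij.
  under eq_bigr => a _.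
    under eq_bigr => b _ do rewrite (agree_mul _ _ _ ijh).
    rewrite sum_agree //; over.
  by rewrite sumr_const card_ord -[_ *+ _]mulr_natr; ring.
rewrite mulrDr; congr (_ + _).
  rewrite big_distrr; apply: eq_bigr => i _ /=; rewrite E //.
  by rewrite (_ : 3 * i = i + i + i)%N ?exprD ?invfM; [ring | lia].
rewrite mulrCA; congr (_ * _); rewrite /Cw big_distrr; apply: eq_bigr => i _ /=.
rewrite big_distrr; apply: eq_bigr => j /ltnW ij /=; rewrite E //.
by rewrite (_ : i + 2 * j = i + j + j)%N ?exprD ?invfM; [ring | lia].
Qed.

Lemma equidistant_attains_bounds (d : R) : (1 < n)%N -> (1 < m)%N ->
  (forall a b, a != b -> dist w D a b = d) -> attains_bounds w D.
Proof.
move=> n_gt1 m_gt1 dE; have n_gt0 := ltnW n_gt1.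
have n0 : n%:R != 0 :> R by rewrite pnatr_eq0 -lt0n.
have m0 : m%:R != 0 :> R by rewrite pnatr_eq0 -lt0n ltnW.
have n1 : n%:R - 1 != 0 :> R by rewrite subr_eq0 pnatr_eq1 gtn_eqF.
have m1 : m%:R - 1 != 0 :> R by rewrite subr_eq0 pnatr_eq1 gtn_eqF.
have dist_diag a : dist w D a a = 0.
  rewrite dist_similarity big1 // => k _; rewrite /A0 /similarity -sumrB big1 // => i _.
  by rewrite /agree eqxx mulr1 subrr.
have sum_row (f : 'I_n -> R) a c : (forall b, a != b -> f b = c) ->
    \sum_b f b = f a + (n%:R - 1) * c.
  move=> fE; rewrite (bigD1 a) //=; congr (_ + _).
  rewrite (eq_bigr (fun=> c)); last by move=> b ba; rewrite fE // eq_sym.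
  rewrite sumr_const (eq_card (B := predC1 a)) // cardC1 card_ord -subn1.
  by rewrite -[_ *+ _]mulr_natl natrB.
(* Balance fixes the sum of the distances from one row, and hence the common distance. *)
have dV : d = n%:R * m%:R * (A0 s w - A1 s w) / (n%:R - 1).
  apply: (canRL (mulfK n1)); rewrite mulrC.
  pose a := Ordinal n_gt0.
  have := sum_row (dist w D a) a d (dE a); rewrite dist_diag add0r => <-.
  under eq_bigr do rewrite dist_similarity.
  rewrite exchange_big /= (eq_bigr (fun=> n%:R * (A0 s w - A1 s w))).
    by rewrite sumr_const card_ord -[_ *+ _]mulr_natr; ring.
  move=> k _; rewrite sumrB sum_similarity sumr_const card_ord -[_ *+ n]mulr_natl; ring.
(* Used twice: [c = 0] gives [G_D], and [c = m%:R * A0 s w] gives the squares of the total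
   similarities. *)
have sum_dist_sqr (c : R) : \sum_a \sum_b (c - dist w D a b) ^+ 2 =
    n%:R * (c ^+ 2 + (n%:R - 1) * (c - d) ^+ 2).
  rewrite (eq_bigr (fun=> c ^+ 2 + (n%:R - 1) * (c - d) ^+ 2)).
    by rewrite sumr_const card_ord -[_ *+ _]mulr_natl.
  by move=> a _; rewrite (sum_row _ a ((c - d) ^+ 2)) ?dist_diag ?subr0 // => b /dE ->.
split=> //.
  rewrite /G_D /G_LB; have := sum_dist_sqr 0.
  under eq_bigr do under eq_bigr do rewrite sub0r sqrrN.
  move=> ->; rewrite dV; field.
  by [].
rewrite /Phi_SD.
under eq_bigr do under eq_bigr do rewrite SD2_similarity //.
pose T k l := n%:R ^- 2 * (\sum_a \sum_b similarity k a b * similarity l a b) - A1 s w ^+ 2.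
have T_sym k l : T k l = T l k.
  rewrite /T; congr (_ * _ - _); apply: eq_bigr => a _; apply: eq_bigr => b _; exact: mulrC.
have T_diag : \sum_k T k k = m%:R * (Bw s w + 2 * Cw s w - A1 s w ^+ 2).
  rewrite (eq_bigr (fun=> Bw s w + 2 * Cw s w - A1 s w ^+ 2)).
    by rewrite sumr_const card_ord -[_ *+ _]mulr_natl.
  by move=> k _; rewrite /T sum_similarity_sqr mulKf // expf_neq0.
have T_all : \sum_k \sum_l T k l = n%:R ^- 2 *
    (\sum_a \sum_b (m%:R * A0 s w - dist w D a b) ^+ 2) - m%:R ^+ 2 * A1 s w ^+ 2.
  transitivity (\sum_k \sum_l n%:R ^- 2 *
      (\sum_a \sum_b similarity k a b * similarity l a b) - m%:R ^+ 2 * A1 s w ^+ 2).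
    under eq_bigr do rewrite sumrB.
    rewrite sumrB; congr (_ - _).
    by rewrite !sumr_const card_ord -!mulrnA -[_ *+ _]mulr_natl natrM expr2.
  congr (_ - _); under eq_bigr do rewrite -big_distrr /=.
  rewrite -big_distrr /=; congr (_ * _).
  under eq_bigr do rewrite exchange_big /=.
  rewrite exchange_big; apply: eq_bigr => a _ /=.
  under eq_bigr do rewrite exchange_big /=.
  rewrite exchange_big; apply: eq_bigr => b _ /=.
  rewrite dist_similarity sumrB sumr_const card_ord -[A0 s w *+ m]mulr_natl subKr.
  rewrite expr2 big_distrl; apply: eq_bigr => k _ /=.
  by rewrite big_distrr.
(* The sum over [k < l] is half of the full sum less its diagonal. *)
have := sum_symmetric T_sym; rewrite T_all T_diag sum_dist_sqr dV => /esym/(canRL (addKr _)) E.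
rewrite -[\sum_(k < m) _](mulKf (x := 2)) // E /Phi_LB; field.
by rewrite n0 n1 m0 m1.
Qed.

End Bounds.

(** * The two constructions *)

Lemma card_fiber_inj (T T' : finType) (f : T -> T') (y : T') :
  injective f -> #|T'| = #|T| -> #|[set x | f x == y]| = 1%N.
Proof.
move=> f_inj cT; have [g fK gK] := inj_card_bij f_inj (eq_leq cT).
rewrite -(cards1 (g y)); apply: eq_card => x; rewrite !inE.
by apply/eqP/eqP => [<-|->].
Qed.

Lemma card_preimage_uniform (n g : nat) (T : finType) (f : 'I_n -> T) (P : pred T) :
  (forall c, (#|[set a | f a == c]| * g)%N = n) ->
  (#|[set a | P (f a)]| * g = n * #|[set x | P x]|)%N.
Proof.
move=> fU; rewrite -sum1_card (partition_big f P) /=; last by move=> a; rewrite inE.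
rewrite big_distrl mulnC -sum_nat_const; apply: eq_big => [x|x Px]; first by rewrite inE.
rewrite sum1dep_card -[RHS](fU x); congr (_ * _)%N; apply: eq_card => a.
by rewrite !inE; case: eqP => [->|]; rewrite ?Px ?andbF.
Qed.

(** The distance of two rows depends only on how many columns agree at each level, so equal counts
    give equidistance. *)
Lemma equal_agreement_attains_bounds (R : realType) (n m s h : nat)
    (w : 'I_h.+1 -> R) (D : design n m s h) (c : nat -> nat) :
  (0 < s)%N -> (1 < n)%N -> (1 < m)%N -> balanced D ->
  (forall a b i, a != b -> (i <= h)%N ->
     #|[set k | level_value D i k a == level_value D i k b]| = c i) ->
  attains_bounds w D.
Proof.
move=> s_gt0 n_gt1 m_gt1 D_bal cE.
apply: (equidistant_attains_bounds s_gt0 D_bal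
  (d := \sum_(i < h.+1) w i * s%:R ^- i * (m%:R - (c i)%:R))) => // a b ab.
rewrite dist_similarity // sumrB sumr_const card_ord exchange_big /=.
rewrite /A0 -sumrMnl -sumrB; apply: eq_bigr => i _.
rewrite -big_distrr mulrBr /= -(cE a b i ab) -1?ltnS // -sum_nat_indic; congr (_ - _).
by rewrite [RHS]mulr_natr.
Qed.

(** A set of [g] columns is the set of all columns, so only full tuples need counting. *)
Lemma is_OA_full_strength (n g : nat) (lev : 'I_g -> nat) (A : 'M[nat]_(n, g)) (N : nat) :
  (forall i j, A i j < lev j)%N ->
  (forall v : 'I_g -> nat, (forall j, v j < lev j)%N ->
    #|[set i | [forall j, A i j == v j]]| = N) ->
  is_OA lev g A.
Proof.
move=> ltA AN; split=> // J cJ v w vJ wJ.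
have JT j : j \in J.
  have : J == [set: 'I_g] by rewrite eqEcard finset.subsetT cardsT card_ord cJ leqnn.
  by move/eqP ->; rewrite inE.
have E (v' : 'I_g -> nat) : (forall j, j \in J -> v' j < lev j)%N ->
    #|[set i | [forall j in J, A i j == v' j]]| = N.
  move=> v'J; rewrite -(AN v') => [|j]; last exact: v'J.
  by apply: eq_card => i; rewrite !inE; apply: eq_forallb => j; rewrite JT.
by rewrite !E.
Qed.

(** * Strength one and strength two of balanced designs *)

Section GSOA.
Variables (n m s h : nat) (D : design n m s h).
Hypotheses (s_gt0 : (0 < s)%N) (D_bal : balanced D).

Lemma balanced_is_OA1 (c : 'I_1 -> 'I_m) (u : 'I_1 -> nat) :
  (forall j, 0 < u j <= h)%N -> is_OA (fun j => s ^ u j)%N 1 (collapse D c u).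
Proof.
move=> uh; have uh0 : (u ord0 <= h)%N by case/andP: (uh ord0).
apply: (@is_OA_full_strength _ _ _ _ (n %/ s ^ u ord0)) => [i j|v vlt].
  by rewrite mxE; apply: level_value_lt; case/andP: (uh j).
rewrite -[in RHS](balanced_level_count s_gt0 D_bal (c ord0) uh0 (vlt ord0)) mulnK ?expn_gt0 ?s_gt0 //.
apply: eq_card => i; rewrite !inE; apply/forallP/eqP => [/(_ ord0)|E j].
  by rewrite mxE => /eqP.
by rewrite mxE [j]ord1 -/(level_value D (u ord0) (c ord0) i) E.
Qed.

Lemma balanced_is_GSOA1 : is_GSOA 1 D.
Proof.
move=> [|[|g]] // _ c _ u uh _; exact: balanced_is_OA1.
Qed.

(** Positive exponents summing to 2 are a single 2, covered by balance, or two 1s, which involve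
    only the leading digits of two columns. *)
Lemma balanced_is_GSOA2 :
  (forall (k l : 'I_m) (x y : nat), k != l -> (x < s)%N -> (y < s)%N ->
    (#|[set a | (level_value D 1 k a == x) && (level_value D 1 l a == y)]| * s ^ 2)%N = n) ->
  is_GSOA 2 D.
Proof.
move=> pairs [|[|[|g]]] // _ c c_inj u uh; first by move=> _; apply: balanced_is_OA1.
rewrite big_ord_recl big_ord1 => u2.
have {u2} u1 j : u j = 1%N.
  have := uh ord0; have := uh (lift ord0 ord0); move: u2.
  case: (unliftP ord0 j) => [j' ->|->]; last by lia.
  by rewrite (_ : j' = ord0) 1?[j']ord1 //; lia.
apply: (@is_OA_full_strength _ _ _ _ (n %/ s ^ 2)) => [i j|v vlt].
  by rewrite mxE; apply: level_value_lt; case/andP: (uh j).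
have cN : c ord0 != c (lift ord0 ord0) by rewrite (inj_eq c_inj).
have lt_v j : (v j < s)%N by have := vlt j; rewrite u1.
rewrite -[in RHS](pairs _ _ (v ord0) (v (lift ord0 ord0)) cN (lt_v _) (lt_v _)) mulnK ?expn_gt0 ?s_gt0 //.
apply: eq_card => i; rewrite !inE; apply/forallP/andP => [E|[E1 E2] j].
  by have := E (lift ord0 ord0); have := E ord0; rewrite !mxE !u1.
rewrite mxE u1; case: (unliftP ord0 j) => [j' ->|->] //.
by rewrite [j']ord1.
Qed.

End GSOA.

(** Inclusion and exclusion: [X], [Y] and their symmetric difference each have n/2 elements, so the
    intersection has n/4. This yields strength two when [s] is 2. *)
Lemma card_pair_of_bits (n : nat) (x y : 'I_n -> nat) (v z : nat) :
  (forall a, x a < 2)%N -> (forall a, y a < 2)%N -> (v < 2)%N -> (z < 2)%N ->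
  (#|[set a | x a == v]| * 2)%N = n -> (#|[set a | y a == z]| * 2)%N = n ->
  (#|[set a | x a == y a]| * 2)%N = n ->
  (#|[set a | (x a == v) && (y a == z)]| * 4)%N = n.
Proof.
move=> x2 y2 v2 z2 xn yn xyn.
set X := [set a | x a == v] in xn; set Y := [set a | y a == z] in yn.
set E := [set a | x a == y a] in xyn.
(* For bits, exactly one of [x a = v] and [y a = z] holds when [x a] and [y a] differ if [v = z],
   and when they agree if not. *)
pose Z := if v == z then ~: E else E.
have Zn : (#|Z| * 2)%N = n.
  by rewrite /Z; case: (v == z) => //; have := cardsC E; rewrite card_ord; lia.
suff : (#|X| + #|Y| = 2 * #|X :&: Y| + #|Z|)%N.
  have -> : [set a | (x a == v) && (y a == z)] = X :&: Y by apply/setP => a; rewrite !inE.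
  lia.
have -> : Z = (X :|: Y) :\: (X :&: Y).
  apply/setP => a; have := x2 a; have := y2 a; rewrite /Z.
  by case: (eqVneq v z) => vz; rewrite !inE; lia.
have sub : X :&: Y \subset X :|: Y by apply: (fintype.subset_trans (finset.subsetIl _ _) (finset.subsetUl _ _)).
have := cardsUI X Y; have := subset_leq_card sub; rewrite cardsD (finset.setIidPr sub); lia.
Qed.

(** * Designs from generalized Hadamard matrices *)

Lemma digit_numbering_prime_power (F : finFieldType) (s p : nat) :
  prime_power s -> #|F| = (s ^ p)%N ->
  exists phi : F -> 'I_(s ^ p), injective phi /\
     forall j x y, (j <= p)%N ->
       (phi x %/ s ^ j == phi y %/ s ^ j)%N = (phi (x - y)%R < s ^ j)%N.
Proof.
move=> [r [e [pr_r e_gt0 ->]]]; rewrite -expnM => cF.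
have [phi [phi_inj phi_lt phiE]] := digit_numbering pr_r cF.
exists (fun x => Ordinal (phi_lt x)); split=> [x y [] /phi_inj //|j x y jp].
(* A base [s] digit is a block of [e] base [r] digits, so the index [j] becomes [e * j]. *)
by rewrite -expnM phiE // leq_mul2l jp orbT.
Qed.

Lemma card_preimage_inj (T : finType) (N : nat) (f : T -> 'I_N) (P : pred 'I_N) :
  injective f -> #|T| = N -> #|[set x | P (f x)]| = #|[set y | P y]|.
Proof.
move=> f_inj cT; rewrite -(card_imset _ f_inj); apply: eq_card => y.
have [g fK gK] := inj_card_bij f_inj (eq_leq (etrans (card_ord N) (esym cT))).
rewrite !inE; apply/imsetP/idP => [[x]|Py]; first by rewrite inE => Px ->.
by exists (g y); rewrite ?inE gK.
Qed.

Lemma prime_power_gt1 s : prime_power s -> (1 < s)%N.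
Proof. by move=> [r [e [pr_r e_gt0 ->]]]; rewrite -(exp1n e) ltn_exp2r ?prime_gt1. Qed.

(** The design keeps the leading [q] of the [p] digits of the normalized matrix [G]. Columns are
    uniform by the column condition on [H], and agreement counts of rows come from the row
    condition. Writing [n = m.+1] lets [lift ord0] index the columns that remain. *)
Lemma GH_equidistant_GSOA (R : realType) (n m s lam p q : nat) (w : 'I_q.+1 -> R) :
  prime_power s -> (0 < q)%N -> (q <= p)%N -> n = m.+1 -> n = (lam * s ^ p)%N -> (1 < m)%N ->
  GH_exists n (s ^ p) ->
  exists D : design n m s q,
    is_GSOA (if s == 2%N then 2%N else 1%N) D /\ attains_bounds w D.
Proof.
move=> s_pp q_gt0 qp En Elam m_gt1 [F [H [cF GH]]]; subst n.
have s_gt1 := prime_power_gt1 s_pp; have s_gt0 := ltnW s_gt1.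
have sX_gt0 j : (0 < s ^ j)%N by rewrite expn_gt0 s_gt0.
have cancel A N i : (i <= p)%N -> (A * s ^ p = N * s ^ (p - i) -> A * s ^ i = N)%N.
  move=> ip; rewrite -{1}(subnKC ip) expnD mulnA => /eqP.
  by rewrite eqn_pmul2r // => /eqP.
have [phi [phi_inj phiE]] := digit_numbering_prime_power s_pp cF.
have card_phi j c : (j <= p)%N -> (c < s ^ (p - j))%N ->
    #|[set x | (phi x %/ s ^ j)%N == c]| = (s ^ j)%N.
  move=> jp cj; rewrite (card_preimage_inj (fun y : 'I__ => (y %/ s ^ j)%N == c) phi_inj cF).
  by apply: card_divn_fiber cj; rewrite -expnD subnK.
have card_phi_lt j (c : F) : (j <= p)%N -> #|[set x : F | (phi (x - c)%R < s ^ j)%N]| = (s ^ j)%N.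
  move=> jp; rewrite -[RHS](card_phi j 0%N) //.
  rewrite -(card_imset _ (addIr (- c))); apply: eq_card => y; rewrite !inE.
  rewrite -[(_ == 0)%N]leqn0 -[(_ <= 0)%N]ltnS ltn_divLR // mul1n.
  apply/imsetP/idP => [[x]|yj]; first by rewrite inE => xj ->.
  by exists (y + c); rewrite ?inE addrK.
pose G a (k : 'I_m) := H a (lift ord0 k) - H a ord0.
have D_lt a k : (phi (G a k) %/ s ^ (p - q) < s ^ q)%N.
  by rewrite ltn_divLR // -expnD subnKC.
pose D : design m.+1 m s q := \matrix_(a, k) Ordinal (D_lt a k).
have levelE i k a : (i <= q)%N -> level_value D i k a = (phi (G a k) %/ s ^ (p - i))%N.
  move=> iq; rewrite /level_value mxE /= -divnMA -expnD.
  by congr (_ %/ _ ^ _)%N; lia.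
have colU k c : (#|[set a | G a k == c]| * s ^ p)%N = m.+1.
  by rewrite -[in LHS]cF GH.
have level_count i k c : (i <= q)%N -> (c < s ^ i)%N ->
    (#|[set a | level_value D i k a == c]| * s ^ i)%N = m.+1.
  move=> iq ci; have ip := leq_trans iq qp.
  have := card_preimage_uniform (fun x => (phi x %/ s ^ (p - i))%N == c) (colU k).
  rewrite card_phi ?leq_subr ?subKn // => /cancel E.
  by rewrite -[in RHS](E ip); congr (_ * _)%N; apply: eq_card => a; rewrite !inE levelE.
have D_bal : balanced D.
  have DE k x : (#|[set a | D a k == x]| * s ^ q)%N = m.+1.
    rewrite -[in RHS](level_count q k x) //; congr (_ * _)%N; apply: eq_card => a.
    by rewrite !inE /level_value subnn expn0 divn1 val_eqE.
  by move=> k x y; apply/eqP; rewrite -(eqn_pmul2r (sX_gt0 q)) !DE.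
(* Among all columns of [H] the count is [lam * s ^ (p - i)]; the 1 subtracted is the deleted column
   [ord0], where the difference to itself is zero. *)
have cnt a b i : a != b -> (i <= q)%N ->
    #|[set k | level_value D i k a == level_value D i k b]| = (lam * s ^ (p - i) - 1)%N.
  move=> ab iq; have ip := leq_trans iq qp.
  pose f k := H a k - H b k.
  have rowU c : (#|[set k | f k == c]| * s ^ p)%N = m.+1.
    rewrite -cF -[RHS](is_GH_tr GH ab c); congr (_ * _)%N.
    by apply: eq_card => k; rewrite !inE !mxE.
  have := card_preimage_uniform (fun x => (phi (x - f ord0)%R < s ^ (p - i))%N) rowU.
  rewrite card_phi_lt ?leq_subr // => E.
  have <- : #|[set k | (phi (f k - f ord0)%R < s ^ (p - i))%N]| = (lam * s ^ (p - i))%N.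
    by apply/eqP; rewrite -(eqn_pmul2r (sX_gt0 p)) E Elam mulnAC.
  rewrite (cardsD1 ord0) inE subrr.
  rewrite (_ : (phi 0%R < _)%N = true) ?add1n ?subn1 /=; last first.
    by rewrite -(subrr (0 : F)) -phiE ?leq_subr // eqxx.
  rewrite -(card_imset _ (@lift_inj _ ord0)); apply: eq_card => k'.
  rewrite !inE; apply/imsetP/andP => [[k]|[k0 kf]].
    rewrite inE !levelE // phiE ?leq_subr // => Gk ->; split; first by rewrite eq_sym neq_lift.
    by move: Gk; rewrite /G /f; congr (phi _ < _)%N; ring.
  case: (unliftP ord0 k') k0 kf => [k -> _ kf|->]; last by rewrite eqxx.
  exists k => //; rewrite inE !levelE // phiE ?leq_subr //.
  by move: kf; rewrite /G /f; congr (phi _ < _)%N; ring.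
exists D; split; last first.
  apply: (@equal_agreement_attains_bounds R _ _ _ _ w D (fun i => lam * s ^ (p - i) - 1)%N) => //.
  exact: ltnW m_gt1.
have [s2|_] := eqVneq s 2%N; last exact: balanced_is_GSOA1.
apply: balanced_is_GSOA2 => // k l x y kl xs ys.
have p_gt0 := leq_trans q_gt0 qp.
rewrite (_ : s ^ 2 = 4)%N; last by rewrite s2.
apply: card_pair_of_bits => [a|a|||||]; rewrite -?s2 //.
- by rewrite -[ltnRHS]expn1; apply: level_value_lt.
- by rewrite -[ltnRHS]expn1; apply: level_value_lt.
- by rewrite -[X in (_ * X)%N]expn1 level_count ?expn1.
- by rewrite -[X in (_ * X)%N]expn1 level_count ?expn1.
have kl' : lift ord0 k != lift ord0 l by rewrite (inj_eq lift_inj).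
(* The normalizing column cancels in [G a k - G a l], which is thus uniform; hence the leading bits
   of two columns agree in half of the rows. *)
have difU (c : F) : (#|[set a | (H a (lift ord0 k) - H a (lift ord0 l))%R == c]| * s ^ p)%N = m.+1.
  by rewrite -[in LHS]cF GH.
have := card_preimage_uniform (fun x => (phi (x - 0)%R < s ^ (p - 1))%N) difU.
rewrite card_phi_lt ?leq_subr // => /cancel E.
rewrite -[in RHS](E p_gt0) expn1; congr (_ * _)%N; apply: eq_card => a.
rewrite !inE !levelE // phiE ?leq_subr //.
by rewrite /G; congr (phi _ < _)%N; ring.
Qed.

(** * Designs from the affine plane *)

Lemma enumeration (T : finType) (n : nat) : #|T| = n -> exists f : 'I_n -> T, bijective f.
Proof.
move=> cT; exists (enum_val \o cast_ord (esym cT)).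
by apply: bij_comp (enum_val_bij T) _; exists (cast_ord cT); [apply: cast_ordKV | apply: cast_ordK].
Qed.

Section AffinePlane.
Variable F : finFieldType.

(* Points of the plane are the pairs (x, y) of field elements; [Some m] indexes the parallel
   class of slope [- m] and [None] that of the vertical lines. *)
Definition line_coord (k : option F) (P : F * F) : F * F :=
  if k is Some m then (P.2 + m * P.1, P.1) else P.

Lemma line_coord_inj k : injective (line_coord k).
Proof.
case: k => [m|] // [x y] [x' y'] /= [E xx']; move: E.
by rewrite xx' => /addIr ->.
Qed.

Lemma card_common_line (P Q : F * F) : P != Q ->
  #|[set k | (line_coord k P).1 == (line_coord k Q).1]| = 1%N.
Proof.
case: P Q => [x y] [x' y']; rewrite xpair_eqE => PQ.
(* Points with equal abscissas share a vertical line; otherwise y + m x = y' + m x' determines m. *)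
pose k0 := if x == x' then None else Some ((y - y') / (x' - x)).
rewrite -(cards1 k0); apply: eq_card => k; rewrite !inE /k0.
have [Ex|xx'] := eqVneq x x'.
  move: PQ; rewrite Ex eqxx /= => yy'.
  by case: k => [m|]; rewrite /= ?eqxx // (inj_eq (addIr _)) (negbTE yy').
have d0 : x' - x != 0 by rewrite subr_eq0 eq_sym.
case: k => [m|] /=; last exact/negbTE.
apply/eqP/eqP => [E|[->]].
  congr Some; apply: (mulIf d0); rewrite divfK //.
  by rewrite (_ : y = y' + m * x' - m * x); [ring | rewrite -E addrK].
by field.
Qed.

End AffinePlane.

Lemma affine_plane_GSOA (R : realType) (s : nat) (w : 'I_3 -> R) :
  prime_power s ->
  exists D : design (s ^ 2) (s + 1) s 2, [/\ balanced D, is_GSOA 2 D & attains_bounds w D].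
Proof.
move=> s_pp; have s_gt1 := prime_power_gt1 s_pp; have s_gt0 := ltnW s_gt1.
have [F cF] : exists F : finFieldType, #|F| = s.
  by case: s_pp => r [e [pr_r e_gt0 ->]]; have [F _ cF] := pPrimePowerField pr_r e_gt0; exists F.
have cFF : #|{: F * F}| = (s ^ 2)%N by rewrite card_prod cF.
have cO : #|{: option F}| = (s + 1)%N by rewrite card_option cF addn1.
have [pt pt_bij] := enumeration cFF; have [sl sl_bij] := enumeration cO.
have [ix [ix' ixK ixK']] := enumeration cF.
have D_lt (P : F * F) : (ix' P.1 * s + ix' P.2 < s ^ 2)%N.
  rewrite (leq_trans (n := ix' P.1 * s + s)%N) ?ltn_add2l //.
  by rewrite addnC -mulSn leq_mul2r ltn_ord orbT.
pose D : design (s ^ 2) (s + 1) s 2 :=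
  \matrix_(a, k) Ordinal (D_lt (line_coord (sl k) (pt a))).
have pt_inj := bij_inj pt_bij; have sl_inj := bij_inj sl_bij.
have level1 k a : level_value D 1 k a = ix' (line_coord (sl k) (pt a)).1.
  by rewrite /level_value mxE /= expn1 divnMDl // divn_small ?addn0.
have D_inj k : injective (D^~ k).
  move=> a b E; apply: pt_inj; apply: (@line_coord_inj _ (sl k)).
  move/(congr1 val): E; rewrite !mxE /= => E.
  have := congr1 (divn^~ s) E; have := congr1 (modn^~ s) E.
  rewrite /= !modnMDl !divnMDl // !modn_small // !divn_small // !addn0.
  move=> /val_inj /(can_inj ixK') E2 /val_inj /(can_inj ixK') E1.
  by rewrite [LHS]surjective_pairing E1 E2 -surjective_pairing.
have D_bal : balanced D.
  by move=> k x y; rewrite !(card_fiber_inj _ (@D_inj k)) // !card_ord.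
(* All columns agree at level 0, only the class of the common line at level 1, and none at level
   2. *)
pose cnt i := if i == 0%N then (s + 1)%N else (i == 1%N : nat).
have cntE a b i : a != b -> (i <= 2)%N ->
    #|[set k | level_value D i k a == level_value D i k b]| = cnt i.
  move=> ab; case: i => [|[|[|]]] // _.
  - rewrite -[RHS](card_ord (s + 1)) -cardsT; apply: eq_card => k.
    by rewrite !inE /level_value !divn_small.
  - rewrite -[RHS](@card_common_line F (pt a) (pt b)) ?(inj_eq pt_inj) //.
    rewrite -(card_imset _ sl_inj).
    have [sl' slK slK'] := sl_bij.
    apply: eq_card => k; rewrite !inE; apply/imsetP/idP => [[k']|E].
      by rewrite inE !level1 val_eqE (inj_eq (can_inj ixK')) => E ->.
    by exists (sl' k); rewrite ?slK' // inE !level1 slK' val_eqE (inj_eq (can_inj ixK')).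
  - apply/eqP; rewrite cards_eq0; apply/eqP/setP => k; rewrite !inE.
    by rewrite /level_value subnn expn0 !divn1 val_eqE (inj_eq (@D_inj k)); apply/negbTE.
exists D; split=> //; last first.
  apply: (@equal_agreement_attains_bounds R _ _ _ _ w D cnt) => //; last by lia.
  by rewrite -(exp1n 2) ltn_exp2r.
apply: balanced_is_GSOA2 => // k l x y kl xs ys.
have lt1 k' a : (level_value D 1 k' a < s)%N by rewrite -[ltnRHS]expn1; apply: level_value_lt.
pose f a := (Ordinal (lt1 k a), Ordinal (lt1 l a)).
(* Distinct points with the same image would share lines of two classes. Injectivity and equal
   cardinalities then give each pair of leading digits once. *)
have f_inj : injective f.
  move=> a b [Ek El]; apply/eqP; apply: contraT => ab.
  have := cntE a b 1%N ab isT; rewrite /cnt /= => C.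
  have : [set k; l] \subset [set k' | level_value D 1 k' a == level_value D 1 k' b].
    by apply/fintype.subsetP => k'; rewrite !inE => /orP[] /eqP ->; rewrite ?Ek ?El.
  by move/subset_leq_card; rewrite C cards2 kl.
rewrite -[RHS]mul1n; congr (_ * _)%N.
rewrite -[RHS](card_fiber_inj (Ordinal xs, Ordinal ys) f_inj) ?card_prod ?card_ord //.
Qed.

Theorem proposition2 (R : realType) :
  (forall (s lam p q : nat) (w : 'I_q.+1 -> R),
     prime_power s -> (0 < lam)%N -> (0 < q)%N -> (q <= p)%N ->
     (2 <= lam * s ^ p - 1)%N ->
     weight_function w ->
     GH_exists (lam * s ^ p)%N (s ^ p)%N ->
     exists D : design (lam * s ^ p)%N (lam * s ^ p - 1)%N s q,
       is_GSOA (if s == 2%N then 2%N else 1%N) D /\ attains_bounds w D)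
  /\
  (forall (s : nat) (w : 'I_3 -> R),
     prime_power s ->
     weight_function w ->
     exists D : design (s ^ 2)%N (s + 1)%N s 2,
       [/\ balanced D, is_GSOA 2 D & attains_bounds w D]).
Proof.
split=> [s lam p q w s_pp lam_gt0 q_gt0 qp m_gt1 _ GH|s w s_pp _].
  by apply: GH_equidistant_GSOA GH => //; lia.
exact: affine_plane_GSOA.
Qed.
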